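(* Let $q$ be a prime power and $n\ge 1$ an integer such that $n+1$ is a prime and $q$ is a primitive root modulo $n+1$, and let $N$ be the type I optimal normal basis of $\mathbb{F}_{q^n}$ over $\mathbb{F}_q$. Then the complexity of the dual basis of $N$ is $3n-3$ when $q$ is even, and $3n-2$ when $q$ is odd.
   Context: A normal basis of $\mathbb{F}_{q^n}$ over $\mathbb{F}_q$ is a basis of the form $\{\alpha,\alpha^q,\ldots,\alpha^{q^{n-1}}\}$; writing $\alpha_i=\alpha^{q^i}$, define $t_{ij}\in\mathbb{F}_q$ by $\alpha\cdot\alpha_i=\sum_{j=0}^{n-1}t_{ij}\alpha_j$ for $0\le i\le n-1$; the complexity of the normal basis is the number of nonzero entries of the $n\times n$ matrix $(t_{ij})$. The dual basis of a basis $\{\beta_1,\ldots,\beta_n\}$ of $\mathbb{F}_{q^n}$ over $\mathbb{F}_q$ is the basis $\{\beta_1^*,\ldots,\beta_n^*\}$ with $\mathrm{Tr}_{\mathbb{F}_{q^n}/\mathbb{F}_q}(\beta_i\beta_j^* )=\delta_{ij}$ for all $1\le i,j\le n$; the dual of a normal basis is again a normal basis. When $n+1$ is prime and $q$ is primitive modulo $n+1$, the type I optimal normal basis of $\mathbb{F}_{q^n}$ over $\mathbb{F}_q$ is the set $\{\alpha,\alpha^2,\ldots,\alpha^n\}$ of all $(n+1)$-th roots of unity different from $1$ (here $\alpha$ is any $(n+1)$-th root of unity $\neq 1$); it equals $\{\alpha,\alpha^q,\ldots,\alpha^{q^{n-1}}\}$ and is a normal basis. *)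

(* Defs.v *)
From HB Require Import structures.
From mathcomp Require Import all_boot all_order all_fingroup all_algebra.
From mathcomp Require Import all_solvable all_field.

Set Implicit Arguments.
Unset Strict Implicit.
Unset Printing Implicit Defensive.

Import GRing.Theory.
Local Open Scope ring_scope.

(* The base field F is F_q with q = #|F|, and L is F_(q^n) with n the degree  *)
(* of L over F.  Every finite extension of a finite field is a splitting      *)
(* field, so taking L : splittingFieldType F, which makes the library's Galois *)
(* trace available, loses no generality.  A basis is a tuple; a basis given   *)
(* as a set is a tuple up to perm_eq.                                         *)

Definition frob_orbit (F : finFieldType) (L : splittingFieldType F) (n : nat)
    (a : L) : n.-tuple L :=
  [tuple a ^+ (#|F| ^ i) | i < n].

Definition normal_basis (F : finFieldType) (L : splittingFieldType F) (n : nat)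
    (B : n.-tuple L) : Prop :=
  basis_of {:L} B /\ exists a : L, perm_eq B (frob_orbit n a).

(* The coefficients are meaningful when frob_orbit n a is a basis of L.       *)
Definition mult_table (F : finFieldType) (L : splittingFieldType F) (n : nat)
    (a : L) : 'M[F]_n :=
  \matrix_(i < n, j < n) coord (frob_orbit n a) j (a * a ^+ (#|F| ^ i)).

(* The table depends on which element a generates the normal basis, the       *)
(* number of its nonzero entries does not; hence the quantification over all  *)
(* generators.                                                                *)
Definition has_complexity (F : finFieldType) (L : splittingFieldType F)
    (n : nat) (B : n.-tuple L) (c : nat) : Prop :=
  normal_basis B /\
  forall a : L, perm_eq B (frob_orbit n a) ->
    #|[set ij : 'I_n * 'I_n | mult_table n a ij.1 ij.2 != 0]| = c.

Definition dual_basis (F : finFieldType) (L : splittingFieldType F) (n : nat)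
    (B B' : n.-tuple L) : Prop :=
  basis_of {:L} B' /\
  forall i j : 'I_n,
    galTrace 1%AS {:L} (tnth B i * tnth B' j) = (i == j)%:R.

Definition typeI_onb (F : finFieldType) (L : splittingFieldType F) (n : nat)
    (B : n.-tuple L) : Prop :=
  exists a : L,
    [/\ a ^+ n.+1 = 1, a != 1 & perm_eq B [tuple a ^+ i.+1 | i < n]].

(* Main.v *)
(* Put p = n + 1.  All nontrivial p-th roots of unity are conjugate, hence have
   the same trace t, so z^i and z^-j - 1 have trace product
   (Tr 1 - t) delta_ij: up to a factor s in F, the dual of N consists of the
   elements z^r - 1 with r in F_p nonzero.  Writing E r = z^r - 1, the identity
   E 1 * E r = E (1 + r) - E 1 - E r, with E 0 = 0, gives the multiplication
   table, whose nonzero entries are counted over pairs of nonzero residues. *)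

Require Import Defs.
From HB Require Import structures.
From mathcomp Require Import all_boot all_order all_fingroup all_algebra.
From mathcomp Require Import all_solvable all_field.
From mathcomp Require Import ring zify.

Set Implicit Arguments.
Unset Strict Implicit.
Unset Printing Implicit Defensive.

Import GRing.Theory.
Local Open Scope ring_scope.

Lemma prim_root_neq0 (R : fieldType) m (x : R) : m.-primitive_root x -> x != 0.
Proof.
move=> prim_x; rewrite -unitfE -(unitrX_pos _ (prim_order_gt0 prim_x)).
by rewrite (prim_expr_order prim_x) unitr1.
Qed.

(** * The Frobenius map, the trace and coordinates in a dual basis *)

Section Frobenius.

Variables (F : finFieldType) (L : splittingFieldType F).

(** Viewing the [q]-power map as a Galois element makes it additive and shows that the trace is
    invariant under it. *)
Lemma frobenius_gal :
  {g : gal_of {:L} | g \in 'Gal({:L} / 1)%g & forall x : L, g x = x ^+ #|F|}.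
Proof.
have [g /eqP defG gE] := finField_galois_generator (sub1v {:L}%AS).
exists g => [|x]; first by rewrite defG cycle_id.
by rewrite gE ?memvf // dimv1 expn1.
Qed.

Lemma exprBcard (x y : L) : (x - y) ^+ #|F| = x ^+ #|F| - y ^+ #|F|.
Proof. by have [g _ gE] := frobenius_gal; rewrite -!gE rmorphB. Qed.

Lemma expr_cardX_scaleB1 (s : F) (z : L) i :
  (s *: (z - 1)) ^+ (#|F| ^ i) = s *: (z ^+ (#|F| ^ i) - 1).
Proof.
elim: i => [|i IHi]; first by rewrite expn0 !expr1.
by rewrite expnSr !exprM IHi exprZn expf_card exprBcard expr1n.
Qed.

Lemma galTrace_cardX (x : L) i :
  galTrace 1%AS {:L} (x ^+ (#|F| ^ i)) = galTrace 1%AS {:L} x.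
Proof.
have [g galg gE] := frobenius_gal; elim: i => [|i IHi].
  by rewrite expn0 expr1.
by rewrite expnSr exprM -gE galTrace_gal ?memvf.
Qed.

Lemma galTraceZ (c : F) (x : L) :
  galTrace 1%AS {:L} (c *: x) = c *: galTrace 1%AS {:L} x.
Proof. by rewrite scaler_sumr; apply: eq_bigr => g _; rewrite linearZ. Qed.

(** Since [#|F|] is a positive power of the characteristic, it is even exactly in characteristic 2.
    This is where the parity of [q] enters. *)
Lemma natr2_neq0_finField : (2%:R != 0 :> F) = odd #|F|.
Proof.
have cardF0 : #|F|%:R == 0 :> F.
  by rewrite -FinRing.zmodXgE -cardsT expg_cardG ?inE.
have [p p_pr charFp] := finPcharP F.
have cardFp : #|F| = (p ^ logn p #|F|)%N := card_pprimeChar charFp.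
have [p2|p_odd] := even_prime p_pr.
  move: charFp; rewrite p2 => charF2; rewrite pcharf0 // eqxx.
  apply/esym/negbTE; rewrite -dvdn2 (dvdn_pcharf charF2); exact: cardF0.
rewrite cardFp oddX p_odd orbT -(dvdn_pcharf charFp).
by apply: contraL p_odd; rewrite dvdn_prime2 // => /eqP->.
Qed.

(** After expanding [x] in [B'], the pairing with [tnth B i] kills every term but the [i]-th;
    coordinates in the dual basis can thus be read off as traces. *)
Lemma coord_dual_basis n (B B' : n.-tuple L) (x : L) (i : 'I_n) :
  dual_basis B B' ->
  galTrace 1%AS {:L} (tnth B i * x) = (coord B' i x)%:A.
Proof.
case=> basB' dualBB'; rewrite {1}(coord_basis basB' (memvf x)) mulr_sumr.
rewrite raddf_sum (bigD1 i) //= big1 => [|k neq_ki].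
  by rewrite -scalerAr galTraceZ -tnth_nth dualBB' eqxx addr0.
by rewrite -scalerAr galTraceZ -tnth_nth dualBB' eq_sym (negbTE neq_ki) scaler0.
Qed.

End Frobenius.

(** * Roots of unity of prime order, with exponents in ['F_p] *)

Section RootsOfUnity.

Variables (p : nat) (R : fieldType) (z : R).
Hypotheses (p_pr : prime p) (zp1 : z ^+ p = 1) (z_neq1 : z != 1).

Lemma prime_prim_root : p.-primitive_root z.
Proof.
have [m prim_z] := prim_order_exists (prime_gt0 p_pr) zp1.
have /primeP[_ dvp] := p_pr => /dvp/orP[]/eqP m_eq; last by rewrite -m_eq.
by move: z_neq1; rewrite -[z]expr1 -m_eq (prim_expr_order prim_z) eqxx.
Qed.

(** A residue used as an exponent stands for its representative below [p]; as [z ^+ p = 1], any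
    other representative gives the same power. *)
Lemma expr_Fp_nat k : z ^+ (k%:R : 'F_p) = z ^+ k.
Proof. by rewrite val_Fp_nat // (prim_expr_mod prime_prim_root). Qed.

Lemma expr_FpD (x y : 'F_p) : z ^+ (x + y)%R = z ^+ x * z ^+ y.
Proof. by rewrite -[x]natr_Zp -[y]natr_Zp -natrD !expr_Fp_nat exprD. Qed.

Lemma expr_Fp_inj : injective (fun x : 'F_p => z ^+ x).
Proof.
move=> x y /eqP; rewrite (eq_prim_root_expr prime_prim_root).
by rewrite -!val_Fp_nat // !natr_Zp => /eqP/val_inj.
Qed.

End RootsOfUnity.

(** * Nonzero residues as powers of a primitive root, and the count of entries *)

Section PrimitivePowers.

Variables (n : nat) (Q : 'F_n.+1).
Hypotheses (hp : prime n.+1) (primQ : n.-primitive_root Q).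

Lemma Fp_prim_pow (x : 'F_n.+1) : x != 0 -> {i : 'I_n | x = Q ^+ i}.
Proof.
(* Multiplying [x ^+ n = 1] by [x] turns it into Fermat's little theorem. *)
move=> x_neq0; apply: (prim_rootP primQ); apply: (mulfI x_neq0).
by rewrite -exprS mulr1 -[RHS]expf_card card_Fp.
Qed.

Lemma Fp_prim_pow_neq0 i : Q ^+ i != 0.
Proof. by rewrite expf_neq0 // (prim_root_neq0 primQ). Qed.

Lemma Fp_prim_pow_inj : injective (fun i : 'I_n => Q ^+ i).
Proof.
move=> i j /eqP; rewrite (eq_prim_root_expr primQ) => /eqP.
by rewrite !modn_small // => /val_inj.
Qed.

(* The nonzero entries lie on the shifted diagonal [y = 1 + x] and on the two
   lines [y = 1] and [y = x], whose common point [(1, 1)] has the entry [-2]. *)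
Lemma card_table_support (R : nzRingType) :
  #|[set ij : 'I_n * 'I_n |
      (1 + Q ^+ ij.1 == Q ^+ ij.2)%:R - (1 == Q ^+ ij.2)%:R
        - (Q ^+ ij.1 == Q ^+ ij.2)%:R != 0 :> R]|
  = (3 * n.-1 + (2%:R != 0 :> R)%R)%N.
Proof.
(* The count moves from pairs of exponents to pairs of nonzero residues. *)
pose f (ij : 'I_n * 'I_n) := (Q ^+ ij.1, Q ^+ ij.2).
have f_inj : injective f.
  by move=> [i j] [k l] [/Fp_prim_pow_inj-> /Fp_prim_pow_inj->].
set S := [set ij | _]; rewrite -(card_imset _ f_inj).
(* [A] omits [x = -1] because [1 + x] must be nonzero; [B] and [C] omit their common point, which
   [D] treats separately. Each of the first three has [n.-1] elements. *)
pose A : {set 'F_n.+1 * 'F_n.+1} := [set (x, 1 + x) | x in ~: [set 0; -1]].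
pose B : {set 'F_n.+1 * 'F_n.+1} := [set (x, 1) | x in ~: [set 0; 1]].
pose C : {set 'F_n.+1 * 'F_n.+1} := [set (x, x) | x in ~: [set 0; 1]].
pose D : {set 'F_n.+1 * 'F_n.+1} := if 2%:R != 0 :> R then [set (1, 1)] else set0.
have inA x y : ((x, y) \in A) = [&& x != 0, y != 0 & y == 1 + x].
  apply/imsetP/and3P => [[u] | [x0 y0 /eqP y_eq]].
    rewrite !inE negb_or => /andP[u0 uN1] [-> ->]; split=> //.
    by rewrite addrC addr_eq0.
  exists x; last by rewrite y_eq.
  by rewrite !inE negb_or x0 -addr_eq0 addrC -y_eq.
have inB x y : ((x, y) \in B) = [&& x != 0, x != 1 & y == 1].
  apply/imsetP/and3P => [[u] | [x0 x1 /eqP->]].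
    by rewrite !inE negb_or => /andP[u0 u1] [-> ->].
  by exists x; rewrite // !inE negb_or x0.
have inC x y : ((x, y) \in C) = [&& x != 0, x != 1 & y == x].
  apply/imsetP/and3P => [[u] | [x0 x1 /eqP->]].
    by rewrite !inE negb_or => /andP[u0 u1] [-> ->].
  by exists x; rewrite // !inE negb_or x0.
have inD x y : ((x, y) \in D) = [&& 2%:R != 0 :> R, x == 1 & y == 1].
  by rewrite /D; case: ifP; rewrite ?inE.
suff -> : [set f ij | ij in S] = A :|: (B :|: (C :|: D)).
  have dis (X Y : {set 'F_n.+1 * 'F_n.+1}) :
      (forall x y, (x, y) \in X -> (x, y) \in Y -> False) ->
      #|X :|: Y| = (#|X| + #|Y|)%N.
    move=> XY; rewrite cardsU; suff -> : X :&: Y = set0 by rewrite cards0 subn0.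
    apply/setP=> -[x y]; rewrite !inE; apply/negP=> /andP[]; exact: XY.
  have cardC2 (u : 'F_n.+1) : u != 0 -> #|~: [set 0; u]| = n.-1.
    by move=> u0; rewrite cardsCs setCK cards2 eq_sym u0 card_Fp // subn2.
  rewrite !dis.
  - rewrite !card_imset ?cardC2 ?oppr_eq0 ?oner_eq0 //; try by move=> x y [].
    rewrite /D; case: (2%:R != 0 :> R); rewrite ?cards1 ?cards0 /=; lia.
  - move=> x y; rewrite inC inD => /and3P[_ x1 _] /and3P[_ /eqP x1'].
    by rewrite x1' eqxx in x1.
  - move=> x y; rewrite !inE inB inC inD => /and3P[_ x1 /eqP->].
    by rewrite (negbTE x1) /= [1 == x]eq_sym (negbTE x1) !andbF.
  - move=> x y; rewrite !inE inA inB inC inD => /and3P[x0 y0 /eqP yE].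
    have y1 : y != 1 by rewrite yE -subr_eq0 addrAC subrr add0r.
    have yx : y != x by rewrite yE -subr_eq0 addrK oner_eq0.
    by rewrite (negbTE y1) (negbTE yx) !andbF.
have neq1D (x : 'F_n.+1) : (x == 1 + x) = false.
  by rewrite -subr_eq0 opprD addrC subrK oppr_eq0 oner_eq0.
have neqD1 (x : 'F_n.+1) : (1 == 1 + x) = (x == 0).
  by rewrite -{1}[1]addr0 (inj_eq (addrI 1)) eq_sym.
apply/setP=> -[x y].
have -> : ((x, y) \in [set f ij | ij in S]) = [&& x != 0, y != 0 &
    (1 + x == y)%:R - (1 == y)%:R - (x == y)%:R != 0 :> R].
  apply/imsetP/and3P => [[[i j]] | [/Fp_prim_pow[i ->] /Fp_prim_pow[j ->]] xy].
    by rewrite inE /= => ij [-> ->]; split; rewrite ?Fp_prim_pow_neq0.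
  by exists (i, j); rewrite ?inE.
rewrite !inE inA inB inC inD [1 + x == y]eq_sym [1 == y]eq_sym [x == y]eq_sym.
have [->|x0] /= := eqVneq x 0.
  by rewrite andbF.
have [->|yx1] /= := eqVneq y (1 + x).
  rewrite [1 + x == 1]eq_sym neqD1 (negbTE x0) [_ == x]eq_sym neq1D /=.
  by rewrite !subr0 oner_eq0 !andbT !andbF !orbF.
rewrite andbF /= sub0r.
have [->|y1] /= := eqVneq y 1.
  rewrite [1 == x]eq_sym; have [_|x1] /= := eqVneq x 1.
    by rewrite -opprD oppr_eq0 !andbT.
  by rewrite subr0 oppr_eq0 oner_eq0.
rewrite oppr0 sub0r !andbF orbF /=.
have [yx|yx] /= := eqVneq y x; last by rewrite oppr_eq0 eqxx !andbF.
by rewrite -yx y1 yx x0 oppr_eq0 oner_eq0.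
Qed.

End PrimitivePowers.

(** * The dual of the type I basis and its multiplication table *)

Section DualOfTypeI.

Variables (F : finFieldType) (L : splittingFieldType F) (n : nat).
Hypotheses (hp : prime n.+1).
Hypothesis primQ : n.-primitive_root (#|F|%:R : 'F_n.+1).

Local Notation Q := (#|F|%:R : 'F_n.+1).

Lemma expr_cardX_Fp (z : L) i : z ^+ n.+1 = 1 -> z != 1 ->
  z ^+ (#|F| ^ i) = z ^+ (Q ^+ i)%R.
Proof. by move=> zp1 z1; rewrite -natrX expr_Fp_nat. Qed.

Lemma frob_orbit_nth (s : F) (z : L) (i : 'I_n) : z ^+ n.+1 = 1 -> z != 1 ->
  (frob_orbit n (s *: (z - 1)))`_i = s *: (z ^+ (Q ^+ i)%R - 1).
Proof.
move=> zp1 z1; rewrite -tnth_nth tnth_mktuple expr_cardX_scaleB1.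
by rewrite expr_cardX_Fp.
Qed.

Lemma mult_table_scaleB1 (s : F) (z : L) (i j : 'I_n) :
  z ^+ n.+1 = 1 -> z != 1 -> free (frob_orbit n (s *: (z - 1))) ->
  mult_table n (s *: (z - 1)) i j =
    s * ((1 + Q ^+ i == Q ^+ j)%:R - (1 == Q ^+ j)%:R
         - (Q ^+ i == Q ^+ j)%:R).
Proof.
move=> zp1 z1 frB; set B := frob_orbit n (s *: (z - 1)) in frB *.
(* At [y = 0] both sides vanish, since no power of [Q] is zero; this covers the rows with
   [1 + Q ^+ i = 0]. *)
have expand (y : 'F_n.+1) :
    s *: (z ^+ y - 1) = \sum_(k < n) (y == Q ^+ k)%:R *: B`_k.
  have [->|y0] := eqVneq y 0.
    rewrite expr0 subrr scaler0 big1 // => k _.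
    by rewrite eq_sym (negbTE (Fp_prim_pow_neq0 primQ k)) scale0r.
  have [k ->] := Fp_prim_pow hp primQ y0.
  rewrite (bigD1 k) //= eqxx scale1r frob_orbit_nth // big1 ?addr0 // => l.
  rewrite -(inj_eq (Fp_prim_pow_inj primQ)) eq_sym => /negbTE->.
  by rewrite scale0r.
rewrite mxE expr_cardX_scaleB1 expr_cardX_Fp //.
have -> : s *: (z - 1) * (s *: (z ^+ (Q ^+ i)%R - 1)) =
  \sum_(k < n) (s * ((1 + Q ^+ i == Q ^+ k)%:R - (1 == Q ^+ k)%:R
         - (Q ^+ i == Q ^+ k)%:R)) *: B`_k.
  (* By [expand] the three indicator sums fold back, leaving [(z - 1) * (w - 1) = (z * w - 1) - (z -
     1) - (w - 1)] with [w = z ^+ (Q ^+ i)]. *)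
  under eq_bigr do rewrite -scalerA !scalerBl.
  rewrite -scaler_sumr !sumrB -!expand expr_FpD // -scalerAl -scalerAr.
  congr (s *: _); rewrite -!scalerBr; congr (s *: _).
  have ->: z ^+ (1%R : 'F_n.+1) = z := expr_Fp_nat hp zp1 z1 1.
  by rewrite mulrBl mulrBr mul1r mulr1; ring.
by rewrite coord_sum_free.
Qed.

Lemma dual_typeI_nth (N N' : n.-tuple L) :
  (0 < n)%N -> typeI_onb N -> dual_basis N N' ->
  exists s : F, s != 0 /\ forall j, exists z : L,
    [/\ z ^+ n.+1 = 1, z != 1 & tnth N' j = s *: (z - 1)].
Proof.
move=> n_gt0 [z [zp1 z1 permN]] dualN.
have uniqN : uniq [tuple z ^+ i.+1 | i < n].
  rewrite map_inj_uniq ?enum_uniq // => i j /eqP.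
  rewrite (eq_prim_root_expr (prime_prim_root hp zp1 z1)).
  by rewrite !modn_small ?ltnS // => /eqP[] /val_inj.
have NE (i : 'I_n) : exists2 x : 'F_n.+1, x != 0 & tnth N i = z ^+ x.
  have: tnth N i \in [tuple z ^+ i.+1 | i < n].
    by rewrite -(perm_mem permN) mem_tnth.
  case/tnthP=> k ->; exists k.+1%:R; last by rewrite tnth_mktuple expr_Fp_nat.
  by rewrite -(inj_eq val_inj) /= val_Fp_nat // modn_small ?ltnS.
have trE (x : 'F_n.+1) : x != 0 ->
    galTrace 1%AS {:L} (z ^+ x) = galTrace 1%AS {:L} z.
  move=> /(Fp_prim_pow hp primQ)[i ->].
  by rewrite -expr_cardX_Fp // galTrace_cardX.
pose t := galTrace 1%AS {:L} 1 - galTrace 1%AS {:L} z.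
(* For [i != j] the quotient of the two roots is a nontrivial root of unity, so its trace cancels
   that of [tnth N i]. *)
have trN (i j : 'I_n) : galTrace 1%AS {:L} (tnth N i * ((tnth N j)^-1 - 1)) =
    t *+ (i == j).
  have [x x0 NiE] := NE i; have [y y0 NjE] := NE j.
  rewrite mulrBr mulr1 raddfB /= {2}NiE trE //.
  have [-> | neq_ij] := eqVneq i j.
    by rewrite divff ?mulr1n // NjE expf_neq0 // (prim_root_neq0 (prime_prim_root hp zp1 z1)).
  have -> : tnth N i / tnth N j = z ^+ (x - y)%R.
    apply: (canLR (mulfK _)).
      by rewrite NjE expf_neq0 // (prim_root_neq0 (prime_prim_root hp zp1 z1)).
    by rewrite NiE NjE -expr_FpD // subrK.
  rewrite trE ?subrr // subr_eq0; apply: contraNneq neq_ij => xy.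
  have /tuple_uniqP N_inj : uniq N by rewrite (perm_uniq permN).
  by apply/eqP/N_inj; rewrite NiE NjE xy.
(* By [trN] all other coordinates of this element vanish, and [c j] has image [t] in [L], whatever
   [j] is. *)
pose c j := coord N' j ((tnth N j)^-1 - 1).
have cE j : (c j)%:A = t by rewrite -(coord_dual_basis _ _ dualN) trN eqxx.
have cN' j : (tnth N j)^-1 - 1 = c j *: tnth N' j.
  have [basN' _] := dualN.
  rewrite {1}(coord_basis basN' (memvf (_ - 1))) (bigD1 j) //= -tnth_nth.
  rewrite big1 ?addr0 // => i neq_ij.
  have := coord_dual_basis ((tnth N j)^-1 - 1) i dualN.
  rewrite trN (negbTE neq_ij) => /esym/eqP; rewrite mulr0n scaler_eq0 oner_eq0.
  by rewrite orbF => /eqP->; rewrite scale0r.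
pose j0 := Ordinal n_gt0.
have cj0 j : c j = c j0.
  by apply: (fmorph_inj (in_alg L)); rewrite /= !cE.
have Nneq1 j : (tnth N j)^-1 != 1.
  have [x x0 ->] := NE j; rewrite invr_eq1; apply: contraNneq x0 => zx1.
  by apply/eqP/(expr_Fp_inj hp zp1 z1); rewrite /= zx1.
(* A zero constant would force a root in [N] to be 1; the two traces in [t] need not be computed. *)
have c_neq0 : c j0 != 0.
  by apply: contraNneq (Nneq1 j0) => c0; rewrite -subr_eq0 cN' c0 scale0r.
exists (c j0)^-1; split=> [|j]; first by rewrite invr_eq0.
exists (tnth N j)^-1; split=> //.
  by have [x _ ->] := NE j; rewrite exprVn exprAC zp1 expr1n invr1.
by rewrite cN' cj0 scalerK.
Qed.

Lemma has_complexity_dual_typeI (N N' : n.-tuple L) :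
  (0 < n)%N -> typeI_onb N -> dual_basis N N' ->
  has_complexity N' (3 * n.-1 + odd #|F|)%N.
Proof.
move=> n_gt0 typeN dualN; have [basN' _] := dualN.
have [s [s0 N'E]] := dual_typeI_nth n_gt0 typeN dualN.
have freeN' := basis_free basN'.
split.
  split=> //; have [z [zp1 z1 _]] := N'E (Ordinal n_gt0).
  exists (s *: (z - 1)).
  (* Every [w] is a power of [z] with nonzero exponent modulo [n.+1], hence a Frobenius conjugate of
     [z]. Equal sizes and uniqueness then upgrade inclusion to a permutation. *)
  have subN' : {subset N' <= frob_orbit n (s *: (z - 1))}.
    move=> _ /tnthP[j ->]; have [w [wp1 w1 ->]] := N'E j.
    have prim_z := prime_prim_root hp zp1 z1.
    have [k wE] := prim_rootP prim_z wp1.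
    have k0 : (k : nat)%:R != 0 :> 'F_n.+1.
      apply: contraNneq w1 => k0; rewrite wE -(expr_Fp_nat hp zp1 z1).
      by rewrite k0 expr0.
    have [i kE] := Fp_prim_pow hp primQ k0.
    apply/tnthP; exists i; rewrite (tnth_nth 0) frob_orbit_nth //.
    by rewrite -kE expr_Fp_nat // wE.
  have uN' := free_uniq freeN'.
  have szN' : (size (frob_orbit n (s *: (z - 1))) <= size N')%N.
    by rewrite !size_tuple.
  apply: uniq_perm => //; last by case: (uniq_min_size uN' subN' szN').
  by rewrite (leq_size_uniq uN' subN').
move=> a permN'.
(* A generator lies in its own orbit, so it too has the form [s *: (z - 1)] and the table formula
   applies. *)
have: a \in N'.
  rewrite (perm_mem permN'); apply/tnthP; exists (Ordinal n_gt0).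
  by rewrite tnth_mktuple expr1.
case/tnthP=> j aE; have [z [zp1 z1 zE]] := N'E j.
rewrite aE zE in permN' *.
(* The bit [odd #|F|] tells whether the entry [-2] survives; the factor [s] is nonzero and leaves
   the support unchanged. *)
rewrite -(natr2_neq0_finField F) -(card_table_support hp primQ F).
apply: eq_card => ij; rewrite !inE mult_table_scaleB1 ?mulf_eq0 ?(negbTE s0) //.
by rewrite -(perm_free permN').
Qed.

End DualOfTypeI.

Theorem theorem1 (q n : nat) (F : finFieldType) (L : splittingFieldType F)
    (hq : #|F| = q) (hn : (1 <= n)%N) (hL : \dim {:L} = n)
    (hp : prime n.+1)
    (hprim : n.-primitive_root (q%:R : 'F_n.+1))
    (N N' : n.-tuple L) (hN : typeI_onb N) (hN' : dual_basis N N') :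
  (~~ odd q -> has_complexity N' (3 * n - 3)%N) /\
  (odd q -> has_complexity N' (3 * n - 2)%N).
Proof.
subst q; have := has_complexity_dual_typeI hp hprim hn hN hN'.
have -> : (3 * n.-1 = 3 * n - 3)%N by rewrite -subn1 mulnBr.
case: (odd _) => cplx; split=> // _; last by rewrite addn0 in cplx.
(* With [n >= 1] the subtraction is not truncated. *)
by have -> : (3 * n - 2 = 3 * n - 3 + true)%N by lia.
Qed.
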